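(* Suppose the solution sets of (P) and (D) are nonempty, $A$ has full row rank, $\{\tau_k\}$ is positive nonincreasing with $\tau_k\downarrow\tau_\infty>0$, and let $\{(y^l,x^l)\}$ be the infinite sequence generated by Algorithm Snipal with stopping criterion (A'): $\|\nabla\psi_l(y^{l+1})\|\le\frac{\min(\sqrt{\tau_l},1)}{\sigma_l}\epsilon_l$, $\epsilon_l\ge0$, $\sum_l\epsilon_l<\infty$. For $k\ge0$ let $\bar y^{k+1}$ be an exact minimizer of $L_{\sigma_k}(y;x^k)$ over $y\in\mathbb{R}^m$ (assumed to exist). Then: (a) $\bar x^{k+1}:=\Pi_K(x^k-\sigma_k(c-A^T\bar y^{k+1}))$ is the unique solution of $\min\{c^Tx+\frac{1}{2\sigma_k}\|x-x^k\|^2\mid Ax=b,\ x\in K\}$; (b) there exists $\bar\sigma>0$, independent of $k$, such that whenever $\sigma_k\ge\bar\sigma$, $\bar x^{k+1}$ solves (P); (c) if $x^k$ is a solution of (P), then $\bar y^{k+1}$ solves (D).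
   Context: Data: $A\in\mathbb{R}^{m\times n}$, $b\in\mathbb{R}^m$, $c\in\mathbb{R}^n$, $K=\{x\in\mathbb{R}^n\mid l\le x\le u\}$ with $l_i\in[-\infty,\infty)$, $u_i\in(-\infty,\infty]$; $\delta_K$ its indicator, $\delta_K^*$ its conjugate, $\Pi_K$ the projection onto $K$. (P): $\min\{c^Tx+\delta_K(x)\mid Ax=b\}$; (D): $\max\{-\delta_K^*(A^Ty-c)+b^Ty\}$. $L_\sigma(y;x)=-b^Ty-\langle\Pi_K(x-\sigma(c-A^Ty)),c-A^Ty\rangle-\frac{1}{2\sigma}\|\Pi_K(x-\sigma(c-A^Ty))-x\|^2$. Algorithm Snipal: given $(x^0,y^0)$, $\sigma_0>0$, nondecreasing $\sigma_k\uparrow\sigma_\infty\le\infty$; for $k=0,1,\dots$: compute $y^{k+1}$ as an approximate minimizer of $\psi_k(y):=L_{\sigma_k}(y;x^k)+\frac{\tau_k}{2\sigma_k}\|y-y^k\|^2$, then $x^{k+1}=\Pi_K(x^k-\sigma_k(c-A^Ty^{k+1}))$. $\nabla\psi_k(y)=-b+A\Pi_K(x^k+\sigma_k(A^Ty-c))+\tau_k\sigma_k^{-1}(y-y^k)$. *)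

(* Defs.v *)
(* R is a real closed field (needed for Num.sqrt in the norm). *)
From HB Require Import structures.
From mathcomp Require Import all_boot all_order all_algebra.
Set Implicit Arguments. Unset Strict Implicit. Unset Printing Implicit Defensive.
Import Order.TTheory GRing.Theory Num.Theory.
Local Open Scope ring_scope.

Section Defs.
Variable R : rcfType.

Definition dot n (u v : 'cV[R]_n) : R := \sum_(i < n) u i ord0 * v i ord0.
Definition sqnorm n (v : 'cV[R]_n) : R := dot v v.
Definition vnorm n (v : 'cV[R]_n) : R := Num.sqrt (sqnorm v).

(* The box K = {x | l <= x <= u}; None encodes l_i = -oo, resp. u_i = +oo. *)
Definition inK n (lo up : 'I_n -> option R) (x : 'cV[R]_n) : Prop :=
  forall i, (match lo i with Some a => a <= x i ord0 | None => True end) /\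
            (match up i with Some b => x i ord0 <= b | None => True end).

Definition projK n (lo up : 'I_n -> option R) (x : 'cV[R]_n) : 'cV[R]_n :=
  \col_i (let t := x i ord0 in
          let t1 := match lo i with Some a => Num.max a t | None => t end in
          match up i with Some b => Num.min b t1 | None => t1 end).

Definition solves_P m n (A : 'M[R]_(m, n)) (b : 'cV[R]_m) (c : 'cV[R]_n)
    (lo up : 'I_n -> option R) (x : 'cV[R]_n) : Prop :=
  inK lo up x /\ A *m x = b /\
  forall x', inK lo up x' -> A *m x' = b -> dot c x <= dot c x'.

(* t = delta_K^*(z) = sup_{x in K} <z, x>, in the case this sup is finite *)
Definition conjK_val n (lo up : 'I_n -> option R) (z : 'cV[R]_n) (t : R) : Prop :=
  (forall x, inK lo up x -> dot z x <= t) /\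
  (forall t', (forall x, inK lo up x -> dot z x <= t') -> t <= t').

(* y solves (D): max { -delta_K^*(A^T y - c) + b^T y }.  The objective is
   -oo whenever delta_K^* is +oo, so y must have finite objective value
   which dominates every finite objective value. *)
Definition solves_D m n (A : 'M[R]_(m, n)) (b : 'cV[R]_m) (c : 'cV[R]_n)
    (lo up : 'I_n -> option R) (y : 'cV[R]_m) : Prop :=
  exists t, conjK_val lo up (A^T *m y - c) t /\
    forall y' t', conjK_val lo up (A^T *m y' - c) t' ->
      - t' + dot b y' <= - t + dot b y.

Definition Lsig m n (A : 'M[R]_(m, n)) (b : 'cV[R]_m) (c : 'cV[R]_n)
    (lo up : 'I_n -> option R) (sigma : R) (y : 'cV[R]_m) (x : 'cV[R]_n) : R :=
  let w := c - A^T *m y in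
  let p := projK lo up (x - sigma *: w) in
  - dot b y - dot p w - (2 * sigma)^-1 * sqnorm (p - x).

(* gradient of psi_k(y) = L_sigma(y; xk) + tau/(2 sigma) ||y - yk||^2 *)
Definition grad_psi m n (A : 'M[R]_(m, n)) (b : 'cV[R]_m) (c : 'cV[R]_n)
    (lo up : 'I_n -> option R) (sigma tau : R) (xk : 'cV[R]_n) (yk : 'cV[R]_m)
    (y : 'cV[R]_m) : 'cV[R]_m :=
  - b + A *m projK lo up (xk + sigma *: (A^T *m y - c)) + (tau / sigma) *: (y - yk).

Definition cvg_to (u : nat -> R) (l : R) : Prop :=
  forall e : R, 0 < e -> exists N : nat, forall k, (N <= k)%N -> `|u k - l| < e.

End Defs.

(* Main.v *)
Require Import Defs.
From HB Require Import structures.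
From mathcomp Require Import all_boot all_order all_algebra.
From mathcomp Require Import ring lra.
Import Order.TTheory GRing.Theory Num.Theory.
Local Open Scope ring_scope.

(** The subgradient inequality for [L_sigma(.; x^k)] gives [A xbar = b], and the
    variational inequality of the projection then says that [xbar] minimizes the
    strongly convex proximal objective.
    For (b), [xbar] is LP-optimal for the perturbed cost [c + (xbar - x^k) / sigma].
    By Farkas' lemma, for each of the finitely many patterns of active bounds the
    set of costs certified by that pattern is closed, so a perturbation below a
    threshold independent of [k] leaves [c] certified by the same pattern; and
    the perturbation is [O(1 / sigma)] because the iterates [x^k] are bounded, the
    algorithm being an inexact proximal point method with summable errors. This
    works over any real closed field, without compactness.
    For (c), [x^k] optimal forces [xbar = x^k], and the variational inequality
    becomes the KKT condition of (P). *)

(** * Inner product and Cauchy-Schwarz inequality *)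

Section InnerProduct.
Context {R : rcfType}.

Lemma dotC {n} (u v : 'cV[R]_n) : dot u v = dot v u.
Proof. by apply: eq_bigr => i _; rewrite mulrC. Qed.

Lemma dotDl {n} (u v w : 'cV[R]_n) : dot (u + v) w = dot u w + dot v w.
Proof. by rewrite -big_split; apply: eq_bigr => i _; rewrite mxE mulrDl. Qed.

Lemma dotZl {n} a (u w : 'cV[R]_n) : dot (a *: u) w = a * dot u w.
Proof. by rewrite mulr_sumr; apply: eq_bigr => i _; rewrite mxE mulrA. Qed.

Lemma dotNl {n} (u w : 'cV[R]_n) : dot (- u) w = - dot u w.
Proof. by rewrite -scaleN1r dotZl mulN1r. Qed.

Lemma dotDr {n} (w u v : 'cV[R]_n) : dot w (u + v) = dot w u + dot w v.
Proof. by rewrite dotC dotDl !(dotC w). Qed.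

Lemma dotZr {n} a (w u : 'cV[R]_n) : dot w (a *: u) = a * dot w u.
Proof. by rewrite dotC dotZl (dotC w). Qed.

Lemma dotNr {n} (w u : 'cV[R]_n) : dot w (- u) = - dot w u.
Proof. by rewrite dotC dotNl (dotC w). Qed.

Definition dotE := (@dotDl, @dotDr, @dotNl, @dotNr, @dotZl, @dotZr).

Lemma dot0l {n} (w : 'cV[R]_n) : dot 0 w = 0.
Proof. by rewrite -(scale0r 0) dotZl mul0r. Qed.

Lemma dot_adj {m n} (A : 'M[R]_(m, n)) y z : dot (A^T *m y) z = dot y (A *m z).
Proof.
rewrite /dot.
transitivity (\sum_i \sum_j y j ord0 * A j i * z i ord0).
  apply: eq_bigr => i _; rewrite mxE mulr_suml; apply: eq_bigr => j _.
  by rewrite mxE (mulrC (A j i)).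
rewrite exchange_big; apply: eq_bigr => j _; rewrite mxE mulr_sumr.
by apply: eq_bigr => i _; rewrite mulrA.
Qed.

Lemma dot_delta {n} (i : 'I_n) (w : 'cV[R]_n) : dot (delta_mx i ord0) w = w i ord0.
Proof.
rewrite /dot (bigD1 i) //= big1 ?addr0 ?mxE ?eqxx ?mul1r // => j ji.
by rewrite mxE (negPf ji) mul0r.
Qed.

Lemma sqnorm_ge0 {n} (v : 'cV[R]_n) : 0 <= sqnorm v.
Proof. by apply: sumr_ge0 => i _; rewrite -expr2 sqr_ge0. Qed.

Lemma sqnorm_le0 {n} (v : 'cV[R]_n) : sqnorm v <= 0 -> v = 0.
Proof.
move=> v0; have /eqP : sqnorm v = 0 by apply/eqP; rewrite eq_le v0 sqnorm_ge0.
rewrite psumr_eq0 => [/allP h|i _]; last by rewrite -expr2 sqr_ge0.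
apply/colP => i; rewrite mxE; have := h i (mem_index_enum i).
by rewrite /= -expr2 sqrf_eq0 => /eqP.
Qed.

Lemma sqnorm_subC {n} (u v : 'cV[R]_n) : sqnorm (u - v) = sqnorm (v - u).
Proof. by rewrite -opprB /sqnorm dotNl dotNr opprK. Qed.

Lemma cauchy_schwarz {n} (u v : 'cV[R]_n) : dot u v ^+ 2 <= sqnorm u * sqnorm v.
Proof.
have [->|v0] := eqVneq v 0; first by rewrite dotC dot0l expr0n /= mulr_ge0 ?sqnorm_ge0.
have vp : 0 < sqnorm v.
  by rewrite lt_neqAle sqnorm_ge0 andbT eq_sym; apply: contra v0 => /eqP h;
     apply/eqP/sqnorm_le0; rewrite h.
have := sqnorm_ge0 (sqnorm v *: u - dot u v *: v).
rewrite {1}/sqnorm !dotE -!/(sqnorm _) (dotC v u) => h.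
rewrite -subr_ge0 -(pmulr_rge0 _ vp); nra.
Qed.

Lemma dot_le_vnorm {n} (u v : 'cV[R]_n) : dot u v <= vnorm u * vnorm v.
Proof.
rewrite /vnorm -sqrtrM ?sqnorm_ge0 //.
by apply: le_trans (ler_norm _) _; rewrite -sqrtr_sqr ler_wsqrtr ?cauchy_schwarz.
Qed.

End InnerProduct.

(** * Farkas' lemma for finitely generated cones *)

Section Farkas.
Context {R : rcfType} {n : nat}.
Implicit Types (a c d u v : 'cV[R]_n) (s : seq 'cV[R]_n).

Inductive conic s : 'cV[R]_n -> Prop :=
| conic0 : conic s 0
| conicD u l v : conic s u -> v \in s -> 0 <= l -> conic s (u + l *: v).

Lemma conic_cons a s u : conic s u -> conic (a :: s) u.
Proof.
elim=> [|{}u l v _ IH vs l0]; first exact: conic0.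
by apply: conicD => //; rewrite in_cons vs orbT.
Qed.

(** Undoing the projection of a generator [v] moves [- dot v x] times [a] to the other side; this
    coefficient is nonnegative because [x] separates [s]. *)
Lemma conic_proj a x s u : {in s, forall v, dot v x <= 0} ->
  conic [seq v - dot v x *: a | v <- s] u ->
  exists2 l, 0 <= l & conic s (u - l *: a).
Proof.
move=> sx; elim=> [|{}u k _ _ [l l0 IH] /mapP[v vs ->] k0].
  by exists 0 => //; rewrite scale0r subr0; apply: conic0.
exists (l - k * dot v x); first by have := sx v vs; nra.
have -> : u + k *: (v - dot v x *: a) - (l - k * dot v x) *: a = u - l *: a + k *: v.
  by apply/colP => i; rewrite !mxE; ring.
exact: conicD.
Qed.

(* Bartl's induction on the generators: when a separating [x] for [s] fails on [a], project along [a] parallel to the hyperplane orthogonal to [x]. *)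
Lemma farkas s c :
  conic s c \/ exists2 d, {in s, forall v, dot v d <= 0} & 0 < dot c d.
Proof.
move E: (size s) => k; elim: k s E c => [|k IH] [|a s] //= => [_|[sz]] c.
  have [->|c0] := eqVneq c 0; first by left; apply: conic0.
  right; exists c => //; rewrite -/(sqnorm c) lt_neqAle sqnorm_ge0 andbT eq_sym.
  by apply: contra c0 => /eqP h; apply/eqP/sqnorm_le0; rewrite h.
have [cs|[x0 sx0 cx0]]  := IH s sz c; first by left; apply: conic_cons.
have [ax0|ax0] := leP (dot a x0) 0.
  by right; exists x0 => // v; rewrite in_cons => /orP[/eqP->|/sx0].
pose x := (dot a x0)^-1 *: x0.
have ax : dot a x = 1 by rewrite dotZr mulVf ?gt_eqF.
have sx : {in s, forall v, dot v x <= 0}.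
  by move=> v /sx0 h; rewrite dotZr pmulr_rle0 ?invr_gt0.
have cx : 0 < dot c x by rewrite dotZr mulr_gt0 ?invr_gt0.
clearbody x; have [cs|[d sd cd]] := IH [seq v - dot v x *: a | v <- s] (etrans (size_map _ _) sz) (c - dot c x *: a).
  left; have [l l0 cl] := conic_proj _ _ _ _ sx cs.
  rewrite -[c](subrK ((dot c x + l) *: a)); apply: conicD; rewrite ?mem_head //.
    by apply: conic_cons; rewrite scalerDl opprD addrA.
  by rewrite addr_ge0 // ltW.
(* Since [dot a x = 1], this vector is orthogonal to [a], and pairing it with [v] equals pairing [d]
   with the projection of [v]. *)
right; exists (d - dot a d *: x); last by move: cd; rewrite !dotE; lra.
move=> v; rewrite in_cons => /orP[/eqP->|vs]; first by rewrite !dotE ax; lra.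
by have := sd _ (map_f (fun v => v - dot v x *: a) vs); rewrite !dotE; lra.
Qed.

End Farkas.

(** The minimum of finitely many thresholds works for all [t], because each property persists at
    smaller positive values. *)
Lemma uniform_pos (R : realDomainType) (T : finType) (P : T -> R -> Prop) :
  (forall t, exists2 e, 0 < e & forall e', 0 < e' <= e -> P t e') ->
  exists2 e, 0 < e & forall t, P t e.
Proof.
move=> hP; suff [e e0 h] : exists2 e, 0 < e & forall t e', t \in enum T -> 0 < e' <= e -> P t e'.
  by exists e => // t; apply: h; rewrite ?mem_enum // e0 lexx.
elim: (enum T) => [|t s [e e0 IH]]; first by exists 1.
have [e1 e10 h1] := hP t; exists (Num.min e e1); first by rewrite lt_min e0.
move=> t' e'; rewrite in_cons le_min => /orP[/eqP->|t's] /and3P[e'0 h h'].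
  by apply: h1; rewrite e'0.
by apply: IH; rewrite // e'0.
Qed.

(** * Optimality conditions and dual certificates over the box *)

Section Box.
Context {R : rcfType} {m n : nat}.
Implicit Types (A : 'M[R]_(m, n)) (b y : 'cV[R]_m) (c d e x z : 'cV[R]_n).
Implicit Types (lo up : 'I_n -> option R) (L U : {set 'I_n}).

Definition active_lo lo x := [set i | lo i == Some (x i ord0)].
Definition active_up up x := [set i | up i == Some (x i ord0)].

(* [c] lies in [range A^T - N], where [N] is the normal cone of the box at a point whose active bounds are [L] and [U]. *)
Definition dual_cert A L U c y :=
  forall i, (i \notin U -> 0 <= (c - A^T *m y) i ord0) /\
            (i \notin L -> (c - A^T *m y) i ord0 <= 0).

(** Farkas' lemma with generators [f j] and [- f j], spanning the range of the transpose, [e i] for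
    [L] and [- e i] for [U]. The negated separating vector is a descent direction that respects the
    active bounds. *)
Lemma dual_cert_alt A L U c :
  (exists y, dual_cert A L U c y) \/
  exists d, [/\ A *m d = 0, dot c d < 0 &
    forall i, (i \in L -> 0 <= d i ord0) /\ (i \in U -> d i ord0 <= 0)].
Proof.
pose e (i : 'I_n) : 'cV[R]_n := delta_mx i ord0.
pose f (j : 'I_m) : 'cV[R]_n := A^T *m delta_mx j ord0.
pose s := [seq f j | j <- enum 'I_m] ++ [seq - f j | j <- enum 'I_m] ++
          [seq e i | i <- enum L] ++ [seq - e i | i <- enum U].
have [cs|[d sd cd]] := farkas s c.
  left; elim: cs => [|u l v _ [y yu] vs l0].
    by exists 0; rewrite /dual_cert mulmx0 subr0 => i; rewrite mxE.
  move: vs; rewrite !mem_cat => /or4P[] /mapP[j]; rewrite mem_enum => jin ->.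
  - exists (y + l *: delta_mx j ord0).
    by rewrite /dual_cert mulmxDr -scalemxAr [A^T *m y + _]addrC addrKA.
  - exists (y - l *: delta_mx j ord0).
    by rewrite /dual_cert mulmxBr -scalemxAr scalerN [A^T *m y - _]addrC addrKA.
  - exists y => i; have [h1 h2] := yu i.
    rewrite addrAC ![((u - _) + (_ : 'cV_n)) i _]mxE [(l *: (_ : 'cV_n)) i _]mxE [e j i _]mxE eqxx andbT.
    split=> [/h1|iL]; first by move=> h; rewrite addr_ge0 ?mulr_ge0.
    by rewrite (negPf (contraNneq _ iL)) ?mulr0 ?addr0 ?h2 // => ->.
  - exists y => i; have [h1 h2] := yu i.
    rewrite addrAC ![((u - _) + (_ : 'cV_n)) i _]mxE [(l *: (_ : 'cV_n)) i _]mxE [(- e j) i _]mxE [e j i _]mxE eqxx andbT mulrN.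
    split=> [iU|/h2]; last by move=> h; rewrite -oppr_ge0 opprB subr_ge0 (le_trans h) ?mulr_ge0.
    by rewrite (negPf (contraNneq _ iU)) ?mulr0 ?subr0 ?h1 // => ->.
right; exists (- d); split.
- rewrite mulmxN; apply/eqP; rewrite oppr_eq0; apply/eqP/colP => j; rewrite [RHS]mxE.
  have h1 : dot (f j) d <= 0 by apply: sd; rewrite !mem_cat map_f ?mem_enum.
  have h2 : dot (- f j) d <= 0.
    by apply: sd; rewrite !mem_cat (map_f (fun j => - f j)) ?mem_enum ?orbT.
  move: h1 h2; rewrite dotNl dot_adj dot_delta; lra.
- by rewrite dotNr oppr_lt0.
- move=> i; rewrite mxE; split=> iin.
    have : dot (e i) d <= 0 by apply: sd; rewrite !mem_cat map_f ?mem_enum ?orbT.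
    by rewrite dot_delta; lra.
  have : dot (- e i) d <= 0.
    by apply: sd; rewrite !mem_cat (map_f (fun j => - e j)) ?mem_enum ?orbT.
  by rewrite dotNl dot_delta; lra.
Qed.

(* The costs certified by a given active pattern form a closed cone (by Farkas), and there are finitely many patterns. *)
Lemma dual_cert_stable A c : exists2 del, 0 < del & forall L U e,
  sqnorm e < del -> (exists y, dual_cert A L U (c + e) y) ->
  exists y, dual_cert A L U c y.
Proof.
pose P (LU : {set 'I_n} * {set 'I_n}) del := forall e, sqnorm e < del ->
  (exists y, dual_cert A LU.1 LU.2 (c + e) y) -> exists y, dual_cert A LU.1 LU.2 c y.
suff [del del0 h] : exists2 del, 0 < del & forall LU, P LU del.
  by exists del => // L U; apply: (h (L, U)).
apply: uniform_pos => -[L U]; rewrite /P /=.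
have [cert|[d [Ad cd dLU]]] := dual_cert_alt A L U c; first by exists 1.
have d1 : 0 < sqnorm d + 1 by rewrite ltr_wpDl ?sqnorm_ge0.
(* A certificate for [c + e] forces [dot (c + e) d >= 0], hence [dot e d >= - dot c d > 0];
   Cauchy-Schwarz excludes this below the threshold. The [+ 1] keeps the denominator positive. *)
exists (dot c d ^+ 2 / (sqnorm d + 1)).
  by rewrite divr_gt0 // exprn_even_gt0 //= lt_eqF.
move=> del /andP[_ le_del] e /lt_le_trans/(_ le_del) ed [y cert].
have rd : 0 <= dot (c + e - A^T *m y) d.
  apply: sumr_ge0 => i _; have [r0 r1] := cert i; have [dL dU] := dLU i.
  have [/dL iL|/r1 iL] := boolP (i \in L); have [/dU iU|/r0 iU] := boolP (i \in U).
  - have -> : d i ord0 = 0 by apply/le_anti; rewrite iL iU.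
    by rewrite mulr0.
  - exact: mulr_ge0.
  - exact: mulr_le0.
  - have -> : (c + e - A^T *m y) i ord0 = 0 by apply/le_anti; rewrite iL iU.
    by rewrite mul0r.
move: rd; rewrite !dotE dot_adj Ad (dotC y) dot0l subr0 => rd.
have := cauchy_schwarz e d; move: ed; rewrite ltr_pdivlMr //.
by have := sqnorm_ge0 e; have := sqnorm_ge0 d; nra.
Qed.

Definition kkt A c lo up x y :=
  inK lo up x /\ forall z, inK lo up z -> 0 <= dot (c - A^T *m y) (z - x).

Lemma dual_cert_kkt A c lo up x y : inK lo up x ->
  dual_cert A (active_lo lo x) (active_up up x) c y -> kkt A c lo up x y.
Proof.
move=> xK cert; split=> // z zK; apply: sumr_ge0 => i _.
have [r0 r1] := cert i; have [zl zu] := zK i; rewrite [(z - x) i _]mxE [(- x) i _]mxE.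
move: r0 r1; rewrite !inE.
have [lE|_] := eqVneq (lo i) (Some (x i ord0)); have [uE|_] := eqVneq (up i) (Some (x i ord0)).
- move: zl zu; rewrite lE uE => h h' _ _.
  have -> : z i ord0 = x i ord0 by apply/le_anti; rewrite h h'.
  by rewrite subrr mulr0.
- by move: zl; rewrite lE => h /(_ isT) r _; nra.
- by move: zu; rewrite uE => h _ /(_ isT) r; nra.
- move=> /(_ isT) r /(_ isT) r'.
  have -> : (c - A^T *m y) i ord0 = 0 by apply/le_anti; rewrite r r'.
  by rewrite mul0r.
Qed.

Lemma kkt_solves_P A b c lo up x y :
  kkt A c lo up x y -> A *m x = b -> solves_P A b c lo up x.
Proof.
move=> [xK h] Ax; split=> //; split=> // z zK Az.
by have := h z zK; rewrite !dotE !dot_adj Az Ax; lra.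
Qed.

Lemma kkt_solves_D A b c lo up x y :
  kkt A c lo up x y -> A *m x = b -> solves_D A b c lo up y.
Proof.
move=> [xK h] Ax; exists (dot (A^T *m y - c) x); split.
  by split=> [z zK|t']; [have := h z zK; rewrite !dotE; lra|apply].
move=> y' t' [ub _]; have := ub x xK; rewrite !dotE !dot_adj Ax (dotC b) (dotC b); lra.
Qed.

(** Active bounds are respected by the signs of [d], inactive ones leave positive slack, and there
    are finitely many coordinates. *)
Lemma feasible_step lo up x d : inK lo up x ->
  (forall i, (i \in active_lo lo x -> 0 <= d i ord0) /\
             (i \in active_up up x -> d i ord0 <= 0)) ->
  exists2 t, 0 < t & inK lo up (x + t *: d).
Proof.
move=> xK dLU; apply: uniform_pos => i.
have [xl xu] := xK i; have [dl du] := dLU i; move: xl xu dl du; rewrite !inE.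
move Ev: (x i ord0) => v; move Ew: (d i ord0) => w xl xu dl du.
have [e1 e10 h1] : exists2 e1, 0 < e1 & forall t, 0 < t <= e1 ->
    match lo i return Prop with Some a => a <= v + t * w | None => True end.
  case: (lo i) xl dl => [a|] av dl; last by exists 1.
  have [w0|w0] := leP 0 w; first by exists 1 => // e /andP[e0 _]; nra.
  have va : a < v.
    rewrite lt_neqAle av andbT; apply/negP => /eqP E.
    by move: dl; rewrite E eqxx => /(_ isT); rewrite leNgt w0.
  exists ((a - v) / w); first by rewrite ltr_ndivlMr // mul0r subr_lt0.
  by move=> e /andP[e0]; rewrite ler_ndivlMr //; lra.
have [e2 e20 h2] : exists2 e2, 0 < e2 & forall t, 0 < t <= e2 ->
    match up i return Prop with Some a => v + t * w <= a | None => True end.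
  case: (up i) xu du => [a|] va du; last by exists 1.
  have [w0|w0] := leP w 0; first by exists 1 => // e /andP[e0 _]; nra.
  have av : v < a.
    rewrite lt_neqAle va andbT; apply/negP => /eqP E.
    by move: du; rewrite E eqxx => /(_ isT); rewrite leNgt w0.
  exists ((a - v) / w); first by rewrite divr_gt0 ?subr_gt0.
  by move=> e /andP[e0]; rewrite ler_pdivlMr //; lra.
exists (Num.min e1 e2); first by rewrite lt_min e10.
move=> t; rewrite le_min => /and3P[t0 te1 te2].
by rewrite !mxE Ev Ew; split; [apply: h1|apply: h2]; rewrite t0.
Qed.

(** Without a certificate, the alternative yields a feasible descent direction at [x], contradicting
    optimality. *)
Lemma solves_P_kkt A b c lo up x :
  solves_P A b c lo up x -> exists y, kkt A c lo up x y.
Proof.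
move=> [xK [Ax opt]].
have [[y cert]|[d [Ad cd dLU]]] := dual_cert_alt A (active_lo lo x) (active_up up x) c.
  by exists y; apply: dual_cert_kkt.
have [t t0 tK] := feasible_step _ _ _ _ xK dLU.
have := opt _ tK; rewrite mulmxDr -scalemxAr Ad scaler0 addr0 => /(_ Ax).
by rewrite !dotE; nra.
Qed.

End Box.

(** * Projection onto the box *)

Section Projection.
Context {R : rcfType} {n : nat} (lo up : 'I_n -> option R) (w : 'cV[R]_n).
Hypothesis wK : inK lo up w.
Notation proj := (projK lo up).
Implicit Types (u v z : 'cV[R]_n).

(** The witness [w] rules out crossed bounds, for which clamping would leave the box. *)
Lemma projK_in u : inK lo up (proj u).
Proof.
move=> i; rewrite mxE; have [] := wK i.
case: (lo i) (up i) => [a|] [b|] //= h1 h2; split=> //.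
- by rewrite le_min le_max lexx /= andbT; lra.
- by rewrite ge_min lexx.
- by rewrite le_max lexx.
- by rewrite ge_min lexx.
Qed.

Lemma projK_cert u i :
  (i \notin active_up up (proj u) -> 0 <= proj u i ord0 - u i ord0) /\
  (i \notin active_lo lo (proj u) -> proj u i ord0 - u i ord0 <= 0).
Proof.
rewrite !inE !mxE; have [] := wK i; move: (u i ord0) (w i ord0) => t v.
case: (lo i) (up i) => [a|] [b|] //= h1 h2.
- have [at_|ta] := leP a t.
    by have [bt|tb] := leP b t; rewrite ?eqxx; split=> // _; lra.
  have [ba|ab] := leP b a; last by rewrite eqxx; split=> // _; lra.
  have -> : b = a by lra.
  by rewrite eqxx.
- by have [at_|ta] := leP a t; rewrite ?eqxx; split=> // _; lra.
- by have [bt|tb] := leP b t; rewrite ?eqxx; split=> // _; lra.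
- by rewrite subrr.
Qed.

(** This is the KKT condition for the cost [proj u - u] with no equality constraints, so
    [dual_cert_kkt] applies with a matrix of zero rows. *)
Lemma projK_VI u z : inK lo up z -> 0 <= dot (proj u - u) (z - proj u).
Proof.
move=> zK; have [|_] := @dual_cert_kkt R 0 n 0 (proj u - u) lo up (proj u) 0 (projK_in u).
  by move=> i; rewrite mulmx0 subr0 [(proj u - u) i _]mxE [(- u) i _]mxE; apply: projK_cert.
by move/(_ z zK); rewrite mulmx0 subr0.
Qed.

Lemma projK_firm u v : sqnorm (proj u - proj v) <= dot (proj u - proj v) (u - v).
Proof.
have := projK_VI u _ (projK_in v); have := projK_VI v _ (projK_in u).
rewrite /sqnorm !dotE (dotC (proj v) (proj u)) (dotC u (proj u)) (dotC u (proj v)).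
by rewrite (dotC v (proj u)) (dotC v (proj v)); lra.
Qed.

End Projection.

(** * The augmented Lagrangian and the proximal subproblem *)

Section Subproblem.
Context {R : rcfType} {m n : nat} (A : 'M[R]_(m, n)) (b : 'cV[R]_m) (c : 'cV[R]_n).
Context (lo up : 'I_n -> option R) (w0 x : 'cV[R]_n) (sg : R).
Hypotheses (w0K : inK lo up w0) (sg0 : 0 < sg).
Implicit Types (y : 'cV[R]_m) (p z : 'cV[R]_n).

Let P y := projK lo up (x - sg *: (c - A^T *m y)).
Let f z := dot c z + (2 * sg)^-1 * sqnorm (z - x).

Let k_gt0 : 0 < (2 * sg)^-1.
Proof. by rewrite invr_gt0 mulr_gt0. Qed.

Let k_sg : (2 * sg)^-1 * (2 * sg) = 1.
Proof. by rewrite mulVf // gt_eqF // mulr_gt0. Qed.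

Lemma Lsig_ge y p : inK lo up p ->
  - dot b y - dot p (c - A^T *m y) - (2 * sg)^-1 * sqnorm (p - x)
    <= Lsig A b c lo up sg y x.
Proof.
move=> pK; rewrite /Lsig -/(P y); set w := c - _; set q := P y.
have := projK_VI _ _ _ w0K (x - sg *: w) _ pK; rewrite -/(P y) -/q => VI.
have pq := sqnorm_ge0 (p - q).
have : 0 <= 2 * sg * (dot p w - dot q w) + (sqnorm (p - x) - sqnorm (q - x)).
  move: VI pq; clearbody w q; rewrite /sqnorm !dotE (dotC q p) (dotC w p) (dotC w q).
  by rewrite (dotC x p) (dotC x q); lra.
rewrite -(pmulr_rge0 _ k_gt0) mulrDr mulrA k_sg mul1r mulrBr; lra.
Qed.

(* [L_sigma(y; x)] is a maximum over [p] in [K] of functions affine in [y], so [- b + A *m P y'] is a subgradient at [y']. *)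
Lemma Lsig_stationary y : (forall y', Lsig A b c lo up sg y x <= Lsig A b c lo up sg y' x) ->
  A *m P y = b.
Proof.
move=> ymin; apply/eqP; rewrite -subr_eq0; apply/eqP.
set h := A *m P y - b; pose q := A^T *m h.
apply: sqnorm_le0; rewrite leNgt; apply/negP => h0.
have q1 : 0 < sg * (sqnorm q + 1) by rewrite mulr_gt0 // ltr_wpDl ?sqnorm_ge0.
(* A gradient step of this length has [t * sg * sqnorm q <= sqnorm h / 2], so the change in the
   residual cannot cancel [h]; the [+ 1] covers [q = 0]. *)
pose t := sqnorm h / (2 * (sg * (sqnorm q + 1))).
have t0 : 0 < t by rewrite divr_gt0 // mulr_gt0.
have tE : t * (sg * (sqnorm q + 1)) = sqnorm h / 2.
  by rewrite /t; move: q1; set r := sg * _ => r0; field; rewrite gt_eqF.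
(* The affine minorant at [y'] is evaluated at [y], where the value of [Lsig] is least. *)
have sub y' : 0 <= dot (A *m P y' - b) (y' - y).
  have := ymin y'; have := Lsig_ge y (P y') (projK_in _ _ _ w0K _).
  rewrite {3}/Lsig -/(P y') !dotE !(dotC (P y') (A^T *m _)) !dot_adj.
  rewrite (dotC (A *m _) y) (dotC (A *m _) y'); lra.
clearbody t; pose y' := y - t *: h.
have y'E : y' - y = - (t *: h) by rewrite /y' addrC addKr.
have firm := projK_firm _ _ _ w0K (x - sg *: (c - A^T *m y')) (x - sg *: (c - A^T *m y)).
move: firm; rewrite -!/(P _).
have -> : x - sg *: (c - A^T *m y') - (x - sg *: (c - A^T *m y)) = - (t * sg) *: q.
  rewrite /q /y' mulmxBr -scalemxAr; move: (A^T *m h) (A^T *m y) => a1 a2.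
  by apply/colP => i; rewrite !mxE; ring.
set D := P y' - P y => firm.
have Dq : dot (A *m P y' - b) h = sqnorm h + dot D q.
  rewrite /D /q !(dotC _ (A^T *m h)) dot_adj mulmxBr /sqnorm.
  rewrite !(dotC h) -dotDl; congr (dot _ _); rewrite /h.
  by move: (A *m P y') (A *m P y) => a1 a2; apply/colP => i; rewrite !mxE; ring.
(* Firmness and this square give [dot D q >= - t * sg * sqnorm q], whereas [sub] demands
   [dot D q <= - sqnorm h]. *)
clearbody D q h; have := sqnorm_ge0 (D + (t * sg) *: q).
move: (sub y') firm; rewrite y'E dotNr dotZr Dq oppr_ge0 pmulr_rle0 // /sqnorm !dotE (dotC q D).
rewrite -!/(sqnorm _) => sub' firm sq.
have ts : 0 < t * sg by rewrite mulr_gt0.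
have : 0 <= t * sg * (dot D q + t * sg * sqnorm q) by lra.
rewrite pmulr_rge0 //. lra.
Qed.

(** In the variational inequality at [z] the multiplier term vanishes, since both points satisfy the
    equality constraint. The extra square is strong convexity, which later gives uniqueness. *)
Lemma prox_opt y z : A *m P y = b -> inK lo up z -> A *m z = b ->
  f (P y) + (2 * sg)^-1 * sqnorm (z - P y) <= f z.
Proof.
move=> Aq zK Az; rewrite /f.
have := projK_VI _ _ _ w0K (x - sg *: (c - A^T *m y)) _ zK; rewrite -/(P y).
move: Aq; set q := P y; clearbody q => Aq VI.
have : 0 <= 2 * sg * (dot c z - dot c q) + (sqnorm (z - x) - sqnorm (q - x) - sqnorm (z - q)).
  move: VI; rewrite /sqnorm !dotE !dot_adj Aq Az (dotC q z) (dotC x z) (dotC x q); lra.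
rewrite -(pmulr_rge0 _ k_gt0) mulrDr mulrA k_sg mul1r !mulrBr; lra.
Qed.

(** The linear cost of [P y] is no smaller than that of [xs], so its proximal term must be no
    larger. *)
Lemma prox_closer y xs : A *m P y = b -> solves_P A b c lo up xs ->
  sqnorm (P y - x) <= sqnorm (xs - x).
Proof.
move=> Aq [xsK [Axs opt]].
have := prox_opt _ _ Aq xsK Axs; have := opt _ (projK_in _ _ _ w0K _) Aq.
have := sqnorm_ge0 (xs - P y); rewrite -(pmulr_rge0 _ k_gt0) /f -/(P y) => h1 h2 h3.
rewrite -(ler_pM2l k_gt0); lra.
Qed.

(** The perturbed reduced cost is the projection residual divided by [sg], whose signs [projK_cert]
    supplies. *)
Lemma prox_dual_cert y :
  dual_cert A (active_lo lo (P y)) (active_up up (P y)) (c + sg^-1 *: (P y - x)) y.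
Proof.
pose u := x - sg *: (c - A^T *m y); move=> i; rewrite /P -/u.
have -> : c + sg^-1 *: (projK lo up u - x) - A^T *m y = sg^-1 *: (projK lo up u - u).
  move: (projK lo up u) => a1; rewrite /u; move: (A^T *m y) => a2.
  by apply/colP => j; rewrite !mxE; field; rewrite gt_eqF.
have [h1 h2] := projK_cert _ _ _ w0K u i.
rewrite [(sg^-1 *: (_ : 'cV_n)) i _]mxE [((_ : 'cV_n) - u) i _]mxE [(- u) i _]mxE.
by rewrite pmulr_rge0 ?pmulr_rle0 ?invr_gt0.
Qed.

Lemma prox_fixed_kkt y : P y = x -> kkt A c lo up x y.
Proof.
move=> Px; split=> [|z zK]; first by rewrite -Px; apply: projK_in w0K _.
have := projK_VI _ _ _ w0K (x - sg *: (c - A^T *m y)) _ zK; rewrite -/(P y) Px.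
by rewrite opprB addrC subrK dotZl pmulr_rge0.
Qed.

End Subproblem.

(** * Boundedness of the iterates *)

Section Boundedness.
Context {R : rcfType} {m n : nat} (A : 'M[R]_(m, n)) (b : 'cV[R]_m) (c : 'cV[R]_n).
Context (lo up : 'I_n -> option R) (xs : 'cV[R]_n) (ys : 'cV[R]_m).
Hypotheses (xs_kkt : kkt A c lo up xs ys) (Axs : A *m xs = b).

Definition merit (t : R) x y := Num.sqrt (sqnorm (x - xs) + t * sqnorm (y - ys)).

Lemma merit_arg_ge0 t x y : 0 <= t -> 0 <= sqnorm (x - xs) + t * sqnorm (y - ys).
Proof. by move=> t0; rewrite addr_ge0 ?mulr_ge0 ?sqnorm_ge0. Qed.

(* One step is an inexact resolvent of the monotone KKT operator in the metric [|x|^2 + t |y|^2]. *)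
Lemma merit_step (sg t eps : R) x y x1 y1 : 0 < sg -> 0 < t -> 0 <= eps ->
  x1 = projK lo up (x - sg *: (c - A^T *m y1)) ->
  vnorm (grad_psi A b c lo up sg t x y y1) <= Num.min (Num.sqrt t) 1 / sg * eps ->
  merit t x1 y1 <= merit t x y + 2 * eps.
Proof.
move=> sg0 t0 eps0 x1E; have [xsK opt] := xs_kkt.
have VI := projK_VI _ _ _ xsK (x - sg *: (c - A^T *m y1)) _ xsK.
have opt1 := opt _ (projK_in _ _ _ xsK (x - sg *: (c - A^T *m y1))).
move: VI opt1; rewrite -x1E => VI opt1.
rewrite /grad_psi -[A^T *m y1 - c]opprB scalerN -x1E.
set g := - b + _ + _ => gle.
have gE : sg *: g = sg *: (A *m x1 - b) + t *: (y1 - y).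
  by rewrite /g; apply/colP => i; rewrite !mxE; field; rewrite gt_eqF.
(* The factor [Num.sqrt t] of the stopping criterion turns [vnorm (y1 - ys)] into a quantity bounded
   by the merit. *)
have cs : dot (y1 - ys) (sg *: g) <= merit t x1 y1 * eps.
  rewrite dotZr (le_trans (ler_wpM2l (ltW sg0) (dot_le_vnorm _ _))) //.
  have vy := sqrtr_ge0 (sqnorm (y1 - ys)); rewrite -/(vnorm _) in vy.
  have gle' : sg * vnorm g <= Num.sqrt t * eps.
    rewrite -ler_pdivlMl // (le_trans gle) // mulrCA mulrA ler_wpM2r //.
    by rewrite ler_pM2r ?invr_gt0 // ge_min lexx.
  rewrite mulrCA (le_trans (ler_wpM2l vy gle')) // mulrA ler_wpM2r //.
  rewrite -sqrtrM ?sqnorm_ge0 // ler_wsqrtr // mulrC lerDr ?sqnorm_ge0 //.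
have key : sqnorm (x1 - xs) + t * sqnorm (y1 - ys)
   <= sqnorm (x - xs) + t * sqnorm (y - ys) + 2 * dot (y1 - ys) (sg *: g).
  have := sqnorm_ge0 (x1 - x); have := sqnorm_ge0 (y1 - y).
  rewrite -(pmulr_rge0 _ t0); move: VI; have := mulr_ge0 (ltW sg0) opt1; rewrite gE.
  clear - Axs sg0 t0; rewrite /sqnorm !dotE !dot_adj Axs.
  rewrite (dotC ys y1) (dotC y y1) (dotC ys y) (dotC xs x1) (dotC x x1) (dotC xs x).
  by lra.
have D0 := sqrtr_ge0 (sqnorm (x - xs) + t * sqnorm (y - ys)).
have D1 := sqrtr_ge0 (sqnorm (x1 - xs) + t * sqnorm (y1 - ys)).
have := sqr_sqrtr (merit_arg_ge0 _ x y (ltW t0)).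
have := sqr_sqrtr (merit_arg_ge0 _ x1 y1 (ltW t0)).
rewrite -!/(merit _ _ _) in D0 D1 *; move=> E1 E0.
(* With [D1], [D0] the new and old merits, [key] and [cs] give [D1 ^+ 2 <= D0 ^+ 2 + 2 * D1 * eps],
   which fails if [D1 > D0 + 2 * eps]. *)
rewrite leNgt; apply/negP => lt01; nra.
Qed.

Lemma iterates_bounded (x : nat -> 'cV[R]_n) (y : nat -> 'cV[R]_m) (sg t eps : nat -> R) M :
  (forall k, 0 < sg k) -> (forall k, 0 < t k) -> (forall k, t k.+1 <= t k) ->
  (forall k, 0 <= eps k) -> (forall N, \sum_(i < N) eps i <= M) ->
  (forall k, vnorm (grad_psi A b c lo up (sg k) (t k) (x k) (y k) (y k.+1))
               <= Num.min (Num.sqrt (t k)) 1 / sg k * eps k) ->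
  (forall k, x k.+1 = projK lo up (x k - sg k *: (c - A^T *m y k.+1))) ->
  exists B, forall k, sqnorm (xs - x k) <= B.
Proof.
move=> sg0 t0 tle eps0 sumM stop xE; pose D k := merit (t k) (x k) (y k).
have DS k : D k <= D 0%N + 2 * \sum_(i < k) eps i.
  elim: k => [|k IH]; first by rewrite big_ord0 mulr0 addr0.
  rewrite big_ord_recr /= mulrDr addrA.
  (* Passing from weight [t k.+1] to the larger [t k] can only increase the merit. *)
  apply: (@le_trans _ _ (merit (t k) (x k.+1) (y k.+1))).
    by rewrite ler_wsqrtr // lerD2l ler_wpM2r ?sqnorm_ge0.
  apply: le_trans (merit_step _ _ _ _ _ _ _ (sg0 k) (t0 k) (eps0 k) (xE k) (stop k)) _.
  by rewrite lerD2r.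
exists ((D 0%N + 2 * M) ^+ 2) => k.
have := DS k; have := sumM k; have := sqr_sqrtr (merit_arg_ge0 _ (x k) (y k) (ltW (t0 k))).
have := sqrtr_ge0 (sqnorm (x k - xs) + t k * sqnorm (y k - ys)).
rewrite -!/(merit _ _ _) -!/(D _) sqnorm_subC.
have : 0 <= t k * sqnorm (y k - ys) by rewrite mulr_ge0 ?sqnorm_ge0 ?ltW.
nra.
Qed.

End Boundedness.

Theorem mainTheorem11 (R : rcfType) (m n : nat)
  (A : 'M[R]_(m, n)) (b : 'cV[R]_m) (c : 'cV[R]_n)
  (lo up : 'I_n -> option R)
  (x : nat -> 'cV[R]_n) (y : nat -> 'cV[R]_m)
  (sigma tau eps : nat -> R) (tau_inf : R)
  (ybar : nat -> 'cV[R]_m) :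
  (* solution sets of (P) and (D) nonempty *)
  (exists xs, solves_P A b c lo up xs) ->
  (exists ys, solves_D A b c lo up ys) ->
  (* A has full row rank *)
  \rank A = m ->
  (* sigma_0 > 0, sigma_k nondecreasing *)
  0 < sigma 0%N -> (forall k, sigma k <= sigma k.+1) ->
  (* tau_k positive, nonincreasing, tau_k -> tau_inf > 0 *)
  (forall k, 0 < tau k) -> (forall k, tau k.+1 <= tau k) ->
  cvg_to tau tau_inf -> 0 < tau_inf ->
  (* eps_l >= 0, sum eps_l < oo *)
  (forall l, 0 <= eps l) ->
  (exists M, forall N, \sum_(i < N) eps i <= M) ->
  (* stopping criterion (A') *)
  (forall l, vnorm (grad_psi A b c lo up (sigma l) (tau l) (x l) (y l) (y l.+1))
               <= Num.min (Num.sqrt (tau l)) 1 / sigma l * eps l) ->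
  (* x-update of Snipal *)
  (forall k, x k.+1 = projK lo up (x k - sigma k *: (c - A^T *m y k.+1))) ->
  (* ybar k is an exact minimizer of L_{sigma_k}(. ; x^k) *)
  (forall k y', Lsig A b c lo up (sigma k) (ybar k) (x k)
                 <= Lsig A b c lo up (sigma k) y' (x k)) ->
  let xbar := fun k => projK lo up (x k - sigma k *: (c - A^T *m ybar k)) in
  (* (a) *)
  (forall k,
     let f := fun z => dot c z + (2 * sigma k)^-1 * sqnorm (z - x k) in
     (inK lo up (xbar k) /\ A *m xbar k = b /\
      (forall z, inK lo up z -> A *m z = b -> f (xbar k) <= f z)) /\
     (forall z, inK lo up z -> A *m z = b ->
        (forall z', inK lo up z' -> A *m z' = b -> f z <= f z') -> z = xbar k)) /\
  (* (b) *)
  (exists sbar : R, 0 < sbar /\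
     forall k, sbar <= sigma k -> solves_P A b c lo up (xbar k)) /\
  (* (c) *)
  (forall k, solves_P A b c lo up (x k) -> solves_D A b c lo up (ybar k)).
Proof.
move=> [xs xsP] _ _ sg00 sgS tau0 tauS _ _ eps0 [M sumM] stop xE ymin xbar.
have [w0K [Axs _]] := xsP.
have sg0 k : 0 < sigma k by elim: k => // k /lt_le_trans; apply.
have Axbar k : A *m xbar k = b by apply: Lsig_stationary w0K (sg0 k) _ (ymin k).
have xbarK k : inK lo up (xbar k) by apply: projK_in w0K _.
have opt k z (zK : inK lo up z) (Az : A *m z = b) :=
  prox_opt _ _ _ _ _ _ _ _ w0K (sg0 k) _ _ (Axbar k) zK Az.
have kpos k : 0 < (2 * sigma k)^-1 by rewrite invr_gt0 mulr_gt0.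
have uniq k z : inK lo up z -> A *m z = b ->
    dot c z + (2 * sigma k)^-1 * sqnorm (z - x k)
      <= dot c (xbar k) + (2 * sigma k)^-1 * sqnorm (xbar k - x k) -> z = xbar k.
  move=> zK Az le; apply/eqP; rewrite -subr_eq0; apply/eqP/sqnorm_le0.
  by rewrite -(pmulr_rle0 _ (kpos k)); have := opt k z zK Az; rewrite -/(xbar k); lra.
split; [|split].
- move=> k f; split.
    split=> //; split=> // z zK Az; have := opt k z zK Az.
    have := mulr_ge0 (ltW (kpos k)) (sqnorm_ge0 (z - xbar k)).
    rewrite -/(xbar k) /f; lra.
  by move=> z zK Az zopt; apply: uniq => //; apply: zopt.
- have [ys xs_kkt] := solves_P_kkt _ _ _ _ _ _ xsP.
  have [B xB] := iterates_bounded _ _ _ _ _ _ _ xs_kkt Axs _ _ _ _ _ _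
    sg0 tau0 tauS eps0 sumM stop xE.
  have [del del0 stable] := dual_cert_stable A c.
  have B0 : 0 <= B := le_trans (sqnorm_ge0 _) (xB 0%N).
  (* The perturbation has squared norm at most [B / sigma k ^+ 2]; [B < sigma k * del] and
     [1 <= sigma k] bring it below [del]. *)
  exists (1 + B / del); split=> [|k sgk]; first by rewrite ltr_pwDl // divr_ge0 // ltW.
  have small : sqnorm ((sigma k)^-1 *: (xbar k - x k)) < del.
    rewrite /sqnorm dotZl dotZr -/(sqnorm _) !ltr_pdivrMl //.
    apply: le_lt_trans (prox_closer _ _ _ _ _ _ _ _ w0K (sg0 k) _ _ (Axbar k) xsP) _.
    apply: le_lt_trans (xB k) _.
    have : B < sigma k * del by rewrite -ltr_pdivrMr //; lra.
    have : 1 <= sigma k by have := divr_ge0 B0 (ltW del0); lra.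
    have := mulr_gt0 (sg0 k) del0; nra.
  have [yk cert] := stable _ _ _ small
    (ex_intro _ _ (prox_dual_cert _ _ _ _ _ _ _ w0K (sg0 k) (ybar k))).
  exact: kkt_solves_P (dual_cert_kkt _ _ _ _ _ _ (xbarK k) cert) (Axbar k).
- move=> k [xK [Ax xopt]].
  (* At [x k] the proximal term is zero and the linear cost is minimal, so [x k] also minimizes the
     proximal objective. *)
  have xbarE : x k = xbar k.
    apply: uniq => //; rewrite subrr /sqnorm dot0l mulr0 addr0.
    by rewrite (le_trans (xopt _ (xbarK k) (Axbar k))) // lerDl mulr_ge0 ?sqnorm_ge0 // ltW.
  exact: kkt_solves_D (prox_fixed_kkt _ _ _ _ _ _ _ w0K (sg0 k) _ (esym xbarE)) Ax.
Qed.
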